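(* Let $\mathbb D$ be a block design with parameters $(v,b,r,k,\lambda)$ with $k=3$, built on a finite set $V$. For $S\subseteq V$ let $\varphi(\mathbb D,S)$ be as in the context. (i) The $3$-element subsets $S$ of $V$ fall into two classes according to the value of $\varphi(\mathbb D,S)$, namely $D^{(3)}_1=\mathbb D$ (the blocks of $\mathbb D$) and $D^{(3)}_2$ (the set of all $3$-subsets of $V$ that are not blocks of $\mathbb D$). Both $D^{(3)}_1$ and $D^{(3)}_2$ are block designs, and both are friends with $\mathbb D$. (ii) If moreover $\lambda=1$, the $4$-element subsets $T$ of $V$ fall into two classes according to the value of $\varphi(\mathbb D,T)$, namely $D^{(4)}_1$ (the $4$-subsets of $V$ containing at least one block of $\mathbb D$) and $D^{(4)}_2$ (the $4$-subsets of $V$ containing no block of $\mathbb D$). Both $D^{(4)}_1$ and $D^{(4)}_2$ are block designs, and both are friends with $\mathbb D$.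
   Context: A block design with parameters $(v,b,r,k,\lambda)$ built on a finite set $V$ ($|V|=v$) is a list of $b$ blocks, each a $k$-subset of $V$, such that every element lies in exactly $r$ blocks and every pair of distinct elements lies in exactly $\lambda$ blocks; designs are simple (no repeated blocks). For a design $D$ with blocks $B_1,\dots,B_b$ of size $k$ and $M\subseteq V$, $\varphi(D,M)=(z_0,\dots,z_k)$ where $z_j$ is the number of $s$ with $|M\cap B_s|=j$. Two designs $D_1,D_2$ on $V$ are friends if $\varphi(D_1,D_2^i)$ is independent of the block $D_2^i$ of $D_2$ and $\varphi(D_2,D_1^j)$ is independent of the block $D_1^j$ of $D_1$. The classes in question are the fibres of the map $S\mapsto\varphi(\mathbb D,S)$ on the set of all $n$-element subsets of $V$ (for $n=3$, resp. $n=4$). *)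

(* Defs.v *)
From mathcomp Require Import all_boot.
Set Implicit Arguments.
Unset Strict Implicit.
Unset Printing Implicit Defensive.

(* A simple design is its set of blocks.  No nondegeneracy (b > 0, k < v, ...)
   is imposed, so the empty family is a design with b = r = lambda = 0. *)
Definition block_design (V : finType) (v b r k lambda : nat)
    (D : {set {set V}}) : Prop :=
  [/\ #|V| = v,
      #|D| = b,
      forall B, B \in D -> #|B| = k,
      forall x, #|[set B in D | x \in B]| = r
    & forall x y, x != y ->
        #|[set B in D | (x \in B) && (y \in B)]| = lambda].

(* The block size k of D is explicit: it is the length minus one of the vector,
   and cannot be recovered from D when D is empty. *)
Definition phi (V : finType) (k : nat) (D : {set {set V}}) (M : {set V}) :
    {ffun 'I_k.+1 -> nat} :=
  [ffun j : 'I_k.+1 => #|[set B in D | #|M :&: B| == j]|].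

Definition friends (V : finType) (k1 : nat) (D1 : {set {set V}})
    (k2 : nat) (D2 : {set {set V}}) : Prop :=
  (forall B B', B \in D2 -> B' \in D2 -> phi k1 D1 B = phi k1 D1 B') /\
  (forall B B', B \in D1 -> B' \in D1 -> phi k2 D2 B = phi k2 D2 B').

Definition nsubsets (V : finType) (n : nat) : {set {set V}} :=
  [set S : {set V} | #|S| == n].

(* The set of all nonempty fibres of S |-> phi k D S on the n-subsets. *)
Definition phi_classes (V : finType) (k : nat) (D : {set {set V}}) (n : nat) :
    {set {set {set V}}} :=
  preim_partition (phi k D) (nsubsets V n).

Definition with_block (V : finType) (D : {set {set V}}) (n : nat) :
    {set {set V}} :=
  [set T in nsubsets V n | [exists B in D, B \subset T]].

Definition without_block (V : finType) (D : {set {set V}}) (n : nat) :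
    {set {set V}} :=
  [set T in nsubsets V n | ~~ [exists B in D, B \subset T]].

(* Main.v *)
Require Import Defs.
From mathcomp Require Import all_boot.
From mathcomp Require Import zify.

(** Write z_j(E, M) for the number of blocks of E meeting M in j points.
    Counting blocks, flags and ordered pairs of points of M on a block gives
    three linear equations for z_0, ..., z_3; they show that for a design with
    k = 3 the vector phi(D, M) is determined by |M| and by the number z_3 of
    blocks inside M.  This number is 0 or 1 when |M| = 3, and also when |M| = 4
    and lambda = 1, since two blocks inside a 4-set share two points.
    When lambda = 1, a 4-set containing a block is B + x for a unique block B
    and a unique x outside B, so phi(D^(4)_1, M) is a function of |M| and
    phi(D, M).  For the complementary families one subtracts from the family of
    all n-subsets, whose intersection numbers with M depend on |M| only.  Being
    a design is the case |M| <= 2 of these statements. *)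

Set Implicit Arguments.
Unset Strict Implicit.
Unset Printing Implicit Defensive.

(** * Indicator sums and two-class fibre partitions *)

Lemma card_set_sum (T : finType) (A : {set T}) (P : pred T) :
  #|[set x in A | P x]| = \sum_(x in A) P x.
Proof.
rewrite -sum1_card (eq_bigl (fun x => (x \in A) && P x)); last first.
  by move=> x; rewrite inE.
by rewrite big_mkcondr; apply: eq_bigr => x _; case: (P x).
Qed.

(** On [A] the map [f] separates exactly what [p] separates, so the fibre of [x] is the side of [p]
    on which [x] lies. *)
Lemma preim_partition_two (T : finType) (rT : eqType) (f : T -> rT)
    (A : {set T}) (p : pred T) :
  {in A &, forall x y, (f x == f y) = (p x == p y)} ->
  preim_partition f A =
    [set [set x in A | p x]; [set x in A | ~~ p x]] :\ set0.
Proof.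
move=> fp; have classE x : x \in A ->
    [set y in A | f x == f y] = [set y in A | p x == p y].
  by move=> Ax; apply/setP => y; rewrite !inE; case: (boolP (y \in A)) => //= Ay;
     rewrite fp.
apply/setP => X; rewrite !inE; apply/imsetP/idP => [[x Ax ->]|].
  rewrite classE //; apply/andP; split.
    by apply/set0Pn; exists x; rewrite inE Ax eqxx.
  by case: (p x); apply/orP; [left|right]; apply/eqP/setP => y;
     rewrite !inE; case: (p y).
case/andP=> /set0Pn [x Xx] /orP[] /eqP XE; exists x; move: Xx;
  rewrite XE inE => /andP[Ax px] //; rewrite classE //;
  by apply/setP => y; rewrite !inE; move: px; case: (p x); case: (p y).
Qed.

(** * Intersection numbers of arbitrary families of sets *)

Section IntersectionNumbers.
Variable V : finType.
Implicit Types (E D : {set {set V}}) (M S T B : {set V}) (i j k n : nat).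

(** The entries of [phi], freed from the block size: [j] runs over all naturals. *)
Definition nmeet E M j := #|[set B in E | #|M :&: B| == j]|.

Definition same_profile E M M' := forall j, nmeet E M j = nmeet E M' j.

Lemma same_profile_phi k E M M' : same_profile E M M' -> phi k E M = phi k E M'.
Proof. by move=> h; apply/ffunP => j; rewrite !ffunE; apply: h. Qed.

(** Groups the blocks by the size of their trace on [M]; [F] equal to 1, the identity and the square
    gives the moments of the profile. *)
Lemma sum_nmeet E M (F : nat -> nat) n :
  (forall B, B \in E -> #|B| < n) ->
  \sum_(B in E) F #|M :&: B| = \sum_(i < n) nmeet E M i * F i.
Proof.
move=> En; under [RHS]eq_bigr => i _ do
  rewrite /nmeet card_set_sum big_distrl /=.
rewrite exchange_big /=; apply: eq_bigr => B EB.
have ltn : #|M :&: B| < n.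
  by apply: leq_ltn_trans (En B EB); rewrite subset_leq_card ?subsetIr.
rewrite (bigD1 (Ordinal ltn)) //= eqxx mul1n big1 ?addn0 // => i ne_i.
case: eqP => [e|]; last by rewrite mul0n.
by case/eqP: ne_i; apply: val_inj.
Qed.

(** List each set followed by its complement and match equal positions: the result is a permutation
    of [V] carrying [M] onto [M']. *)
Lemma perm_of_same_card M M' : #|M| = #|M'| ->
  exists2 f : V -> V, injective f & forall x, (f x \in M') = (x \in M).
Proof.
move=> eM; pose s M := enum M ++ enum (~: M).
have sin M0 x : x \in s M0 by rewrite mem_cat !mem_enum inE orbN.
have su M0 : uniq (s M0).
  rewrite cat_uniq !enum_uniq andbT /=; apply/hasPn => x.
  by rewrite !mem_enum inE.
have ss M0 : size (s M0) = #|V| by rewrite size_cat -!cardE cardsC.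
have ilt x : index x (s M) < size (s M') by rewrite ss -(ss M) index_mem.
exists (fun x => nth x (s M') (index x (s M))) => [x y|x].
  rewrite (set_nth_default x y) // => /eqP.
  rewrite nth_uniq // => /eqP exy.
  by rewrite -(nth_index x (sin M x)) exy nth_index.
rewrite nth_cat -cardE -eM cardE.
have -> : (index x (s M) < size (enum M)) = (x \in M).
  rewrite index_cat mem_enum; case: (boolP (x \in M)) => xM.
    by rewrite index_mem mem_enum.
  by rewrite ltnNge leq_addr.
case: (boolP (x \in M)) => xM.
  rewrite -mem_enum mem_nth // -cardE -eM cardE index_cat mem_enum xM.
  by rewrite index_mem mem_enum.
apply/negbTE; rewrite -in_setC -mem_enum mem_nth //.
rewrite index_cat mem_enum (negbTE xM) addKn.
have -> : size (enum (~: M')) = size (enum (~: M)).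
  by have := cardsC M; have := cardsC M'; rewrite -!cardE; lia.
by rewrite index_mem mem_enum inE.
Qed.

(** A permutation carrying [M] onto [M'] permutes the [n]-subsets and preserves trace sizes. *)
Lemma nsubsets_same_profile n M M' :
  #|M| = #|M'| -> same_profile (nsubsets V n) M M'.
Proof.
move=> /perm_of_same_card [f finj fM] j.
have fI S : M' :&: f @: S = f @: (M :&: S).
  apply/setP => y; rewrite inE; apply/andP/imsetP => [[yM /imsetP[x xS yE]]|].
    by exists x => //; rewrite inE xS -fM -yE yM.
  case=> x; rewrite inE => /andP[xM xS] ->; rewrite fM xM; split=> //.
  exact: imset_f.
have [g fK gK] := injF_bij finj.
rewrite /nmeet -(card_imset _ (imset_inj finj)); apply: eq_card => S.
rewrite inE; apply/imsetP/idP => [[S' + ->]|].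
  by rewrite !inE fI !(card_imset _ finj).
rewrite !inE => h; exists (g @: S); last first.
  by rewrite -imset_comp (eq_imset (g := id)) ?imset_id // => x /=; rewrite gK.
have Sg : f @: (g @: S) = S.
  by rewrite -imset_comp (eq_imset (g := id)) ?imset_id // => x /=; rewrite gK.
by move: h; rewrite -{1 2}Sg fI !(card_imset _ finj) !inE.
Qed.

Lemma setD_same_profile E E' M M' : E' \subset E ->
  same_profile E M M' -> same_profile E' M M' -> same_profile (E :\: E') M M'.
Proof.
move=> sE hE hE' j.
have nD M0 : nmeet E M0 j = nmeet (E :\: E') M0 j + nmeet E' M0 j.
  rewrite /nmeet -(cardsID E') addnC; congr (_ + _); apply: eq_card => B.
    by rewrite !inE; case: (B \in E').
  rewrite !inE; case: (boolP (B \in E')) => [/(subsetP sE) ->|]; rewrite ?andbF //=.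
  by rewrite andbT.
by have := hE j; rewrite !nD hE'; lia.
Qed.

(** The replication number is z_1 of a singleton and the pair count is z_2 of a pair. *)
Lemma block_design_of_profiles k E :
  (forall B, B \in E -> #|B| = k) ->
  (forall M M', #|M| = #|M'| -> #|M| <= 2 -> same_profile E M M') ->
  exists b r lambda, block_design #|V| b r k lambda E.
Proof.
move=> Ek hE.
have pt x : #|[set B in E | x \in B]| = nmeet E [set x] 1.
  apply: eq_card => B; rewrite !inE; congr (_ && _).
  case: (boolP (x \in B)) => xB; first by rewrite (setIidPl _) ?sub1set ?cards1.
  by rewrite (_ : _ :&: _ = set0) ?cards0 //; apply/eqP; rewrite setI_eq0 disjoints1.
have pr x y : x != y ->
    #|[set B in E | (x \in B) && (y \in B)]| = nmeet E [set x; y] 2.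
  move=> xy; apply: eq_card => B; rewrite !inE; congr (_ && _).
  have c2 : #|[set x; y]| = 2 by rewrite cards2 xy.
  rewrite -c2 (_ : _ && _ = ([set x; y] \subset B)); last first.
    by rewrite subUset !sub1set.
  apply/idP/eqP => [/setIidPl -> //|c].
  by apply/setIidPl/eqP; rewrite eqEcard subsetIl c leqnn.
have [r hr] : exists r, forall x, #|[set B in E | x \in B]| = r.
  (* If [V] has no point, 0 serves vacuously; likewise below if it has no two distinct points. *)
  case: (pickP [pred x : V | true]) => [x _|V0]; last by exists 0 => x; have := V0 x.
  by exists (nmeet E [set x] 1) => y; rewrite pt; apply: hE; rewrite !cards1.
have [l hl] : exists l, forall x y, x != y ->
    #|[set B in E | (x \in B) && (y \in B)]| = l.
  case: (pickP [pred p : V * V | p.1 != p.2]) => [[x y] /= xy|V0]; last first.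
    by exists 0 => x y xy; have := V0 (x, y); rewrite /= xy.
  exists (nmeet E [set x; y] 2) => x' y' xy'; rewrite pr //.
  by apply: hE; rewrite !cards2 ?xy ?xy'.
by exists #|E|, r, l.
Qed.

(** * Designs with blocks of size 3 *)

Section TripleSystem.
Variables (v b r lambda : nat) (D : {set {set V}}).
Hypothesis hD : block_design v b r 3 lambda D.

Lemma sum_meet M : \sum_(B in D) #|M :&: B| = #|M| * r.
Proof.
case: hD => _ _ _ hr _.
under eq_bigr => B _ do rewrite [#|_|](card_set_sum M (mem B)).
rewrite exchange_big /= -sum_nat_const; apply: eq_bigr => x _.
by rewrite -(hr x) card_set_sum; apply: eq_bigr => B _; case: (_ \in _).
Qed.

(** The square counts ordered pairs of points of [M] on a common block: each [x] contributes [r] on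
    the diagonal and [lambda] for every other point of [M]. *)
Lemma sum_meet_sqr M :
  \sum_(B in D) #|M :&: B| ^ 2 = #|M| * (r + #|M|.-1 * lambda).
Proof.
case: hD => _ _ _ hr hl.
have meetE B : #|M :&: B| = \sum_(x in M) (x \in B) by rewrite -card_set_sum.
under eq_bigr => B _ do rewrite -mulnn meetE big_distrl /=.
rewrite exchange_big /= -sum_nat_const; apply: eq_bigr => x xM.
under eq_bigr => B _ do rewrite big_distrr /=.
rewrite exchange_big /= (bigD1 x) //=; congr (_ + _).
  by rewrite -(hr x) card_set_sum; apply: eq_bigr => B _; case: (_ \in _).
rewrite (cardsD1 x) xM add1n /= -sum_nat_const.
apply: eq_big => [y|y /andP[_ yx]]; first by rewrite !inE andbC.
by rewrite -(hl x y) 1?eq_sym // card_set_sum; apply: eq_bigr => B _; rewrite mulnb.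
Qed.

Lemma nmeet_gt3 M j : 3 < j -> nmeet D M j = 0.
Proof.
case: hD => _ _ h3 _ _ j3; apply/eqP; rewrite cards_eq0; apply/eqP/setP => B.
rewrite !inE; apply/negbTE/negP => /andP[/h3 B3 /eqP e].
by have := subset_leq_card (subsetIr M B); lia.
Qed.

(* The moments of order 0, 1, 2 leave one degree of freedom, fixed by z_3. *)
Lemma triple_same_profile M M' :
  #|M| = #|M'| -> nmeet D M 3 = nmeet D M' 3 -> same_profile D M M'.
Proof.
move=> eM e3; have lt4 B : B \in D -> #|B| < 4 by case: hD => _ _ h _ _ /h ->.
have e0 : \sum_(B in D) 1 = \sum_(B in D) 1 by [].
have e1 : \sum_(B in D) #|M :&: B| = \sum_(B in D) #|M' :&: B|.
  by rewrite !sum_meet eM.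
have e2 : \sum_(B in D) #|M :&: B| ^ 2 = \sum_(B in D) #|M' :&: B| ^ 2.
  by rewrite !sum_meet_sqr eM.
rewrite {1}(sum_nmeet M (fun=> 1) lt4) (sum_nmeet M' (fun=> 1) lt4) in e0.
rewrite !(sum_nmeet _ id lt4) in e1.
rewrite !(sum_nmeet _ (fun n => n ^ 2) lt4) in e2.
move: e0 e1 e2; rewrite !big_ord_recl !big_ord0 /= /bump /= !addn0 !add1n e3 => e0 e1 e2.
(* With z_3 equal, z_0, z_1, z_2 solve a system with Vandermonde matrix on the nodes 0, 1, 2, so
   they agree too. *)
case=> [|[|[|[|j]]]] //; try lia.
by rewrite !nmeet_gt3.
Qed.

Lemma triple_phi_eq M M' : #|M| = #|M'| ->
  (phi 3 D M == phi 3 D M') = (nmeet D M 3 == nmeet D M' 3).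
Proof.
move=> eM; apply/eqP/eqP => [|e3].
  by move/ffunP/(_ (inord 3)); rewrite !ffunE inordK.
by apply/same_profile_phi/triple_same_profile.
Qed.

Lemma triple_nmeet_small M : #|M| <= 2 -> nmeet D M 3 = 0.
Proof.
move=> M2; apply/eqP; rewrite cards_eq0; apply/eqP/setP => B; rewrite !inE.
apply/negbTE/negP => /andP[_ /eqP e].
by have := subset_leq_card (subsetIl M B); lia.
Qed.

Lemma triple_small_same_profile M M' :
  #|M| = #|M'| -> #|M| <= 2 -> same_profile D M M'.
Proof.
by move=> eM M2; apply: triple_same_profile => //; rewrite !triple_nmeet_small -?eM.
Qed.

Lemma triple_meet3 M B : B \in D -> (#|M :&: B| == 3) = (B \subset M).
Proof.
case: hD => _ _ h3 _ _ /h3 B3; apply/eqP/idP => [e|/setIidPr -> //].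
by apply/setIidPr/eqP; rewrite eqEcard subsetIr B3 e leqnn.
Qed.

(** A block inside a 3-set is that set. *)
Lemma nmeet3_triple S : #|S| = 3 -> nmeet D S 3 = (S \in D).
Proof.
move=> S3; have h3 : forall B, B \in D -> #|B| = 3 by case: hD.
have BS B : B \in D -> (#|S :&: B| == 3) = (B == S).
  by move=> DB; rewrite triple_meet3 // eqEcard S3 h3 // leqnn andbT.
case: (boolP (S \in D)) => DS.
  transitivity #|[set S]|; last by rewrite cards1.
  apply: eq_card => B; rewrite !inE.
  by case: (boolP (B \in D)) => [/BS //|/=]; case: eqP => // -> /negP.
apply/eqP; rewrite cards_eq0; apply/eqP/setP => B; rewrite !inE.
case: (boolP (B \in D)) => //= DB; rewrite BS //; apply/eqP => e.
by rewrite -e DB in DS.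
Qed.

Lemma triple_phi_eq3 S S' : #|S| = 3 -> #|S'| = 3 ->
  (phi 3 D S == phi 3 D S') = ((S \in D) == (S' \in D)).
Proof.
move=> S3 S3'; rewrite triple_phi_eq ?S3 // !nmeet3_triple //.
by case: (_ \in _); case: (_ \in _).
Qed.

End TripleSystem.

(** * Steiner triple systems and the 4-sets containing a block *)

Section SteinerTripleSystem.
Variables (v b r : nat) (D : {set {set V}}).
Hypothesis hD : block_design v b r 3 1 D.

(** Two triples inside at most 4 points share at least 3 + 3 - 4 = 2 points, and a pair lies on a
    single block. *)
Lemma steiner_block_inj T B B' : #|T| <= 4 ->
  B \in D -> B' \in D -> B \subset T -> B' \subset T -> B = B'.
Proof.
case: hD => _ _ h3 _ hl T4 DB DB' BT BT'.
have : 1 < #|B :&: B'|.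
  have := cardsUI B B'; rewrite (h3 B) // (h3 B') //.
  have : #|B :|: B'| <= #|T| by rewrite subset_leq_card // subUset BT.
  by lia.
case/card_gt1P => x [y [xI yI xy]].
move: xI yI (hl x y xy); rewrite !inE => /andP[xB xB'] /andP[yB yB'] /eqP.
case/cards1P => B0 /setP e.
have := e B; have := e B'; rewrite !inE DB DB' xB xB' yB yB' /=.
by move=> /esym/eqP -> /esym/eqP ->.
Qed.

Lemma nmeet3_quad T : #|T| = 4 -> nmeet D T 3 = [exists B in D, B \subset T].
Proof.
move=> T4; case: (boolP [exists B in D, _]) => [/exists_inP[B DB BT]|].
  transitivity #|[set B]|; last by rewrite cards1.
  apply: eq_card => B'; rewrite !inE.
  apply/andP/eqP => [[DB']|->]; last by rewrite (triple_meet3 hD).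
  rewrite (triple_meet3 hD) // => BT'.
  by apply: (@steiner_block_inj T); rewrite ?T4.
rewrite negb_exists_in => /forall_inP noB; apply/eqP; rewrite cards_eq0.
apply/eqP/setP => B; rewrite !inE; case: (boolP (B \in D)) => //= DB.
by rewrite (triple_meet3 hD) //; apply/negbTE/noB.
Qed.

Lemma steiner_phi_eq4 T T' : #|T| = 4 -> #|T'| = 4 ->
  (phi 3 D T == phi 3 D T') =
  ([exists B in D, B \subset T] == [exists B in D, B \subset T']).
Proof.
move=> T4 T4'; rewrite (triple_phi_eq hD) ?T4 // !nmeet3_quad //.
by case: [exists B in D, B \subset T]; case: [exists B in D, B \subset T'].
Qed.

(** These pairs parametrize, without repetition, the 4-sets containing a block: join the point to
    the block. *)
Definition antiflags : {set {set V} * V} :=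
  [set p | (p.1 \in D) && (p.2 \notin p.1)].

Lemma with_block_antiflags :
  with_block D 4 = [set p.2 |: p.1 | p in antiflags].
Proof.
have h3 : forall B, B \in D -> #|B| = 3 by case: hD.
apply/setP => T; rewrite !inE.
apply/andP/imsetP => [[/eqP T4 /exists_inP[B DB BT]]|[[B x]]].
  have : 0 < #|T :\: B| by rewrite cardsD (setIidPr BT) T4 h3.
  case/card_gt0P => x; rewrite inE => /andP[xB xT].
  exists (B, x); rewrite ?inE /= ?DB //.
  apply/esym/eqP; rewrite eqEcard subUset sub1set xT BT T4 cardsU1 xB h3 //.
rewrite inE /= => /andP[DB xB] ->; rewrite cardsU1 xB h3 //; split=> //.
by apply/exists_inP; exists B; rewrite ?subsetUr.
Qed.

Lemma antiflags_inj : {in antiflags &, injective (fun p => p.2 |: p.1)}.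
Proof.
have h3 : forall B, B \in D -> #|B| = 3 by case: hD.
move=> [B x] [B' x']; rewrite !inE /= => /andP[DB xB] /andP[DB' xB'] e.
have eB : B = B'.
  apply: (@steiner_block_inj (x |: B)); rewrite ?cardsU1 ?xB ?h3 ?subsetUr //.
  by rewrite e subsetUr.
subst B'; congr (_, _); have : x \in x' |: B by rewrite -e setU11.
by rewrite in_setU1 (negbTE xB) orbF => /eqP.
Qed.

(* Among the points x outside B, |M - B| lie in M, and for those
   |M & (B + x)| = |M & B| + 1. *)
Lemma nmeet_with_block M j : nmeet (with_block D 4) M j =
  \sum_(B in D) ((#|M| - #|M :&: B|) * (#|M :&: B|.+1 == j)
               + (#|V| - (#|M| + 3 - #|M :&: B|)) * (#|M :&: B| == j)).
Proof.
have h3 : forall B, B \in D -> #|B| = 3 by case: hD.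
rewrite /nmeet card_set_sum with_block_antiflags (big_imset _ antiflags_inj) /=.
rewrite (eq_bigl (fun p : {set V} * V => (p.1 \in D) && (p.2 \notin p.1)));
  last by move=> p; rewrite inE.
rewrite -(pair_big_dep (fun B => B \in D) (fun B x => x \notin B)
            (fun B x => #|M :&: (x |: B)| == j : nat)) /=.
apply: eq_bigr => B DB; rewrite (bigID (mem M)) /=.
congr (_ + _).
  rewrite (eq_bigr (fun=> (#|M :&: B|.+1 == j : nat))); last first.
    move=> x /andP[xB xM]; rewrite setIUr cardsU.
    rewrite (setIidPr _) ?sub1set // cards1 (_ : _ :&: (M :&: B) = set0).
      by rewrite cards0 subn0.
    by apply/eqP; rewrite setI_eq0 disjoints1 inE (negbTE xB) andbF.
  rewrite (eq_bigl (fun x => x \in M :\: B)); last by move=> x; rewrite inE.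
  by rewrite sum_nat_const cardsD.
rewrite (eq_bigr (fun=> (#|M :&: B| == j : nat))); last first.
  move=> x /andP[xB xM]; rewrite setIUr (_ : M :&: [set x] = set0) ?set0U //.
  by apply/eqP; rewrite setIC setI_eq0 disjoints1.
(* The remaining points avoid both [M] and [B], and the union has [#|M| + 3 - #|M :&: B|] points. *)
rewrite (eq_bigl (fun x => x \in ~: (M :|: B))); last first.
  by move=> x; rewrite !inE negb_or andbC.
by rewrite sum_nat_const cardsCs setCK cardsU (h3 B).
Qed.

(** The counting formula sees a block only through its trace size, so it is a linear combination of
    the z_i of [D] with coefficients depending on [#|M|]. *)
Lemma with_block_same_profile M M' : #|M| = #|M'| ->
  same_profile D M M' -> same_profile (with_block D 4) M M'.
Proof.
move=> eM hM j; have lt4 B : B \in D -> #|B| < 4 by case: hD => _ _ h _ _ /h ->.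
pose F i := (#|M| - i) * (i.+1 == j) + (#|V| - (#|M| + 3 - i)) * (i == j).
rewrite !nmeet_with_block -eM.
rewrite (sum_nmeet M F lt4) (sum_nmeet M' F lt4).
by apply: eq_bigr => i _; rewrite hM.
Qed.

End SteinerTripleSystem.

(** * Complementary families and the two classifications *)

Lemma without_blockE D n : without_block D n = nsubsets V n :\: with_block D n.
Proof.
by apply/setP => T; rewrite !inE negb_and; case: (_ == n); rewrite ?andbF ?andbT.
Qed.

Lemma with_block_sub D n : with_block D n \subset nsubsets V n.
Proof. by apply/subsetP => T; rewrite inE => /andP[]. Qed.

End IntersectionNumbers.

(* Removing set0 only matters when one of the two families is empty (e.g. when
   every 3-subset is a block): an empty family is not a fibre. *)
Theorem theorem2 (V : finType) (v b r lambda : nat) (D : {set {set V}})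
    (hD : block_design v b r 3 lambda D) :
  (let D1 := D in
   let D2 := nsubsets V 3 :\: D in
   [/\ phi_classes 3 D 3 = [set D1; D2] :\ set0,
       exists b' r' lambda', block_design v b' r' 3 lambda' D1,
       exists b' r' lambda', block_design v b' r' 3 lambda' D2,
       friends 3 D1 3 D
     & friends 3 D2 3 D])
  /\
  (lambda = 1 ->
   let D1 := with_block D 4 in
   let D2 := without_block D 4 in
   [/\ phi_classes 3 D 4 = [set D1; D2] :\ set0,
       exists b' r' lambda', block_design v b' r' 4 lambda' D1,
       exists b' r' lambda', block_design v b' r' 4 lambda' D2,
       friends 4 D1 3 D
     & friends 4 D2 3 D]).
Proof.
have vE : #|V| = v by case: hD.
have h3 B : B \in D -> #|B| = 3 by case: hD => _ _ h _ _ /h.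
have sD : D \subset nsubsets V 3 by apply/subsetP => B /h3; rewrite inE => ->.
(* Every block, seen as a 3-set, has z_3 = 1. *)
have profD B B' : B \in D -> B' \in D -> same_profile D B B'.
  move=> DB DB'; apply: (triple_same_profile hD); rewrite ?h3 //.
  by rewrite !(nmeet3_triple hD) ?h3 // DB DB'.
split=> [D1 D2|l1 D1 D2].
  have D2P S : S \in D2 -> (S \notin D) /\ #|S| = 3.
    by rewrite !inE => /andP[SD /eqP].
  split.
  - rewrite /phi_classes (preim_partition_two (p := mem D)).
      congr ([set _; _] :\ _); apply/setP => S; rewrite !inE 1?andbC //=.
      by case: (boolP (S \in D)) => // /h3 ->; rewrite eqxx.
    by move=> S S'; rewrite !inE => /eqP S3 /eqP S3'; rewrite (triple_phi_eq3 hD).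
  - by exists b, r, lambda.
  - rewrite -vE; apply: block_design_of_profiles => [S /D2P[] //|M M' eM M2].
    apply: setD_same_profile => //; first exact: nsubsets_same_profile.
    exact: (triple_small_same_profile hD).
  - by split=> B B' DB DB'; apply: same_profile_phi; apply: profD.
  (* Non-blocks all have z_3 = 0 with respect to [D]; in the other direction, blocks have equal
     profiles for all triples and for [D], hence for the difference. *)
  - split=> B B' DB DB'; last first.
      case/D2P: DB => /negbTE nB B3; case/D2P: DB' => /negbTE nB' B3'.
      by apply/eqP; rewrite (triple_phi_eq3 hD) // nB nB'.
    apply: same_profile_phi.
    apply: setD_same_profile => //; last exact: profD.
    by apply: nsubsets_same_profile; rewrite !h3.
subst lambda.
have D2E : D2 = nsubsets V 4 :\: D1 by apply: without_blockE.
have D1P T : T \in D1 -> [exists B in D, B \subset T] /\ #|T| = 4.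
  by rewrite !inE => /andP[/eqP].
have D2P T : T \in D2 -> [exists B in D, B \subset T] = false /\ #|T| = 4.
  by rewrite !inE => /andP[/eqP ? /negbTE].
have prof1 B B' : B \in D -> B' \in D -> same_profile D1 B B'.
  by move=> DB DB'; apply: (with_block_same_profile hD); rewrite ?h3 //; apply: profD.
(* Sets of at most 2 points contain no block, so their profiles for [D], and hence for [D1], depend
   on size alone. *)
have small1 (M M' : {set V}) : #|M| = #|M'| -> #|M| <= 2 -> same_profile D1 M M'.
  move=> eM M2; apply: (with_block_same_profile hD) => //.
  exact: (triple_small_same_profile hD).
split.
- rewrite /phi_classes.
  rewrite (preim_partition_two (p := fun T : {set V} => [exists B in D, B \subset T])) //.
  by move=> T T'; rewrite !inE => /eqP T4 /eqP T4'; rewrite (steiner_phi_eq4 hD).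
- by rewrite -vE; apply: block_design_of_profiles => [T /D1P[] //|]; apply: small1.
- rewrite -vE; apply: block_design_of_profiles => [T /D2P[] //|M M' eM M2].
  rewrite D2E; apply: setD_same_profile; first exact: with_block_sub.
    exact: nsubsets_same_profile.
  exact: small1.
- split=> B B' DB DB'; first by apply: same_profile_phi; apply: prof1.
  case/D1P: DB => eB B4; case/D1P: DB' => eB' B4'.
  by apply/eqP; rewrite (steiner_phi_eq4 hD) // eB eB'.
- split=> B B' DB DB'; last first.
    case/D2P: DB => eB B4; case/D2P: DB' => eB' B4'.
    by apply/eqP; rewrite (steiner_phi_eq4 hD) // eB eB'.
  apply: same_profile_phi; rewrite D2E; apply: setD_same_profile.
  + exact: with_block_sub.
  + by apply: nsubsets_same_profile; rewrite !h3.
  + exact: prof1.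
Qed.
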